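(* Let $X \subseteq \{0,1\}^{\mathbb{N}}$ be a subshift. Then $X$ has positive topological entropy if and only if $X$ has an independence set of positive lower asymptotic density.
   Context: $\mathbb{N}$ contains $0$. $\{0,1\}^{\mathbb{N}}$ carries the product topology. A subshift is a closed set $X \subseteq \{0,1\}^{\mathbb{N}}$ with $\sigma(X) \subseteq X$, where $\sigma(x)_i = x_{i+1}$. The words of $X$ are the finite words $w$ such that $x|_{[0,|w|-1]} = w$ for some $x \in X$; $L_n$ denotes the set of words of $X$ of length $n$. The topological entropy is $h(X) = \lim_{n\to\infty} \frac{\log |L_n|}{n}$. An independence set for $X$ is a set $N \subseteq \mathbb{N}$ such that $X|_N = \{0,1\}^N$, where $X|_N = \{x|_N : x \in X\}$ is the set of restrictions to $N$ of points of $X$. The lower asymptotic density of $N \subseteq \mathbb{N}$ is $\liminf_{k\to\infty} \frac{|N \cap [0,k-1]|}{k}$. *)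

(* Defs.v *)
From HB Require Import structures.
From mathcomp Require Import all_boot all_order all_algebra.
From mathcomp Require Import all_classical all_reals all_analysis.
Set Implicit Arguments.
Unset Strict Implicit.
Unset Printing Implicit Defensive.
Import Order.TTheory GRing.Theory Num.Theory.
Import numFieldNormedType.Exports.

Local Open Scope classical_set_scope.
Local Open Scope ring_scope.

(* [cantor_space] is [nat -> bool] with the product topology, [bool] being
   discrete. *)
Definition shift (x : cantor_space) : cantor_space := fun i => x i.+1.

Definition subshift (X : set cantor_space) : Prop :=
  closed X /\ shift @` X `<=` X.

Definition words (X : set cantor_space) (n : nat) : set (n.-tuple bool) :=
  [set [tuple x (val i) | i < n] | x in X].
Arguments words X n : clear implicits.

Definition num_words (X : set cantor_space) (n : nat) : nat :=
  #|[pred w : n.-tuple bool | w \in words X n]|.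

(* The n = 0 term is a division by zero, equal to 0 and irrelevant to the
   limit.  For X empty, [ln 0 = 0] gives entropy 0 rather than -oo. *)
Definition entropy (R : realType) (X : set cantor_space) : R :=
  limn (fun n => ln (num_words X n)%:R / n%:R : R).

(* Restrictions to N are functions on N seen as a type. *)
Definition restriction (N : set nat) (x : cantor_space) : N -> bool :=
  fun i => x (set_val i).
Arguments restriction N x : clear implicits.

Definition independence_set (X : set cantor_space) (N : set nat) : Prop :=
  restriction N @` X = [set: N -> bool].

(* The k = 0 term is again 0 and irrelevant to the limit inferior. *)
Definition lower_density (R : realType) (N : set nat) : R :=
  limn_inf (fun k => #|[pred i : 'I_k | val i \in N]|%:R / k%:R : R).

(* Main.v *)
Require Import Defs.
From mathcomp Require Import all_boot all_order all_algebra.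
From mathcomp Require Import all_classical all_reals all_analysis.
From mathcomp Require Import zify lra.
Set Implicit Arguments.
Unset Strict Implicit.
Unset Printing Implicit Defensive.
Import Order.TTheory GRing.Theory Num.Theory.
Import numFieldNormedType.Exports.
Local Open Scope classical_set_scope.
Local Open Scope ring_scope.

(** An independence set N forces all 2 ^ |N `&` [0, n)| patterns on
    N `&` [0, n) to occur in words of length n, so a positive lower density of N
    makes the number of words grow exponentially.  Counting words is
    submultiplicative, hence by Fekete's argument ([fekete]) the limit defining
    the entropy exists, and this growth rate bounds it from below
    ([num_words_ge]).

    Conversely, suppose the entropy is positive.  A Sauer-Shelah estimate
    ([card_shattered_le]) shows that exponentially many words of length n
    shatter a set of at least c * n positions, for a constant c > 0 and all
    large n ([entropy_shattered]).  Such a set may be dense on average yet start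
    with a long gap.  Cutting it at the point where the count of its elements
    lags most behind the slope c / 2 gives a tail, of length proportional to n,
    all of whose prefixes have density at least c / 2 ([dense_tail]).  Since the
    subshift is closed under the shift, the tail, moved to the origin, is again
    independent.  A limit of these tails in the compact space of binary
    sequences has all its prefixes of density at least c / 2, and all its finite
    parts are independent; a second compactness argument, now in the closed set
    X, makes the whole limit independent ([indep_upto_all]).

    Densities are kept as inequalities n <= q * count between natural numbers,
    q being the inverse of a lower bound on the density. *)

(** * A Sauer-Shelah estimate *)

(** The mask [S] is the indicator word of the set of shattered positions: as
    [nth] defaults to [false], a pattern [u] matters only on that set. *)
Definition shattered n (F : {set n.-tuple bool}) (S : bitseq) : Prop :=
  forall u : nat -> bool, exists2 w, w \in F &
    forall i, nth false S i -> nth false w i = u i.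

(** A form of the Sauer-Shelah lemma in which a free weight [t] replaces the
    sum of binomial coefficients, as in a Chernoff bound.  Induction on the
    length: sort the words by their first letter.  If U (resp. I) is the set of
    tails that follow some letter (resp. both letters), then |F| = |U| + |I|; a
    set shattered by I can be enlarged by the first position, so for I the
    bound on the size of shattered sets drops by one, whence the extra factor
    [t]. *)
Lemma card_shattered_le (R : realType) (t : R) n (F : {set n.-tuple bool}) d :
  0 < t <= 1 ->
  (forall S : bitseq, size S = n -> shattered F S -> (count id S <= d)%N) ->
  #|F|%:R * t ^+ d <= (1 + t) ^+ n.
Proof.
move=> /andP[t0 t1]; elim: n F d => [|n IHn] F d Fd.
  have F1 : #|F|%:R <= 1 :> R.
    by rewrite (ler_nat R _ 1) (leq_trans (max_card _))// card_tuple.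
  by rewrite expr0 mulr_ile1// ?exprn_ge0 ?exprn_ile1// ltW.
pose ext b := [set w : n.-tuple bool | [tuple of b :: w] \in F]%SET.
have cardF :
    #|F| = (#|ext true :|: ext false| + #|ext true :&: ext false|)%N.
  rewrite cardsUI -!sum1_card (bigID (fun w : n.+1.-tuple bool => thead w)) /=.
  have half b : (\sum_(w in F | thead w == b) 1 = \sum_(w in ext b) 1)%N.
    rewrite (reindex_onto (fun w : n.-tuple bool => [tuple of b :: w])
      (fun w => [tuple of behead w])) /=; last first.
      by move=> w /andP[_ /eqP <-]; rewrite -tuple_eta.
    apply: eq_bigl => w; rewrite !inE theadE eqxx andbT andb_idr// => _.
    by apply/eqP/val_inj.
  by congr addn; rewrite -half; apply: eq_bigl => w; case: (thead w).
have union S : size S = n -> shattered (ext true :|: ext false) S ->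
    (count id S <= d)%N.
  move=> nS sS; apply: (Fd (false :: S)); first by rewrite /= nS.
  move=> u; have [w + wu] := sS (fun i => u i.+1).
  by rewrite !inE => /orP[] wF; [exists [tuple of true :: w]
    | exists [tuple of false :: w]] => // -[|i] //= /wu.
have inter S : size S = n -> shattered (ext true :&: ext false) S ->
    (count id S < d)%N.
  move=> nS sS; apply: (Fd (true :: S)); first by rewrite /= nS.
  move=> u; have [w + wu] := sS (fun i => u i.+1).
  rewrite !inE => /andP[wt wf].
  by exists [tuple of u 0%N :: w]; [case: (u 0%N) | case=> [|i] //= /wu].
rewrite cardF natrD mulrDl exprS [leRHS]mulrDl mul1r lerD ?IHn//.
case: d => [|d] in Fd union inter *; last first.
  rewrite exprS mulrCA; apply: (ler_wpM2l (ltW t0)).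
  by apply: IHn => S nS sS; rewrite -ltnS inter.
(* For d = 0 no tail follows both letters, since the empty set is shattered by
   any nonempty set of words. *)
suff -> : ext true :&: ext false = finset.set0.
  by rewrite cards0 mul0r mulr_ge0// ?exprn_ge0 ?addr_ge0// ltW.
apply/eqP; apply: contraT => /set0Pn[w wF].
suff : (count id (nseq n false) < 0)%N by [].
apply: inter; first by rewrite size_nseq.
by move=> u; exists w => // i; rewrite nth_nseq; case: ifP.
Qed.

(** * Compactness of the space of binary sequences *)

Definition agree_upto n (x y : nat -> bool) :=
  forall i, (i < n)%N -> x i = y i.

Lemma nbhs_cylinder (x : cantor_space) n :
  nbhs x [set y : cantor_space | agree_upto n y x].
Proof.
elim: n => [|n IHn]; first by apply: filterS filterT => y _ i.
have xn : nbhs x [set y : cantor_space | y n = x n].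
  apply: (@proj_continuous nat (fun=> bool) n x [set x n]).
  exact: discrete_set1.
apply: filterS2 IHn xn => y xy yn i.
by rewrite ltnS leq_eqVlt => /predU1P[->//|/xy].
Qed.

(** Sequential compactness, in the form needed for diagonal arguments. *)
Lemma agree_limit (X : set cantor_space) (a : nat -> cantor_space) :
    closed X -> (forall m, X (a m)) ->
  exists2 x, X x & forall m, exists2 k, (m <= k)%N & agree_upto m (a k) x.
Proof.
move=> clX Xa.
have cX : compact X.
  exact: subclosed_compact clX cantor_space_compact (@subsetT _ X).
have [|x [Xx ax]] := cX (a @ \oo) _.
  by exists 0%N => // m _; exact: Xa.
exists x => // m.
have am : (a @ \oo) [set y | exists2 k, (m <= k)%N & y = a k].
  by exists m => // k mk; exists k.
have [y [[k mk ->] xy]] := ax _ _ am (nbhs_cylinder x m).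
by exists k.
Qed.

(** * Tails with dense prefixes *)

Definition prefix_count (A : nat -> bool) n := count A (iota 0 n).

Lemma prefix_countD A m n :
  prefix_count A (m + n) =
  (prefix_count A m + prefix_count (fun i => A (m + i)) n)%N.
Proof.
rewrite /prefix_count iotaD count_cat add0n; congr addn.
by rewrite -[m in iota m]addn0 iotaDl count_map.
Qed.

Lemma prefix_count_le A n : (prefix_count A n <= n)%N.
Proof. by rewrite (leq_trans (count_size _ _))// size_iota. Qed.

Lemma eq_prefix_count A B n :
  agree_upto n A B -> prefix_count A n = prefix_count B n.
Proof. by move=> AB; apply: eq_in_count => i; rewrite mem_iota => /AB. Qed.

Lemma prefix_count_nth S : prefix_count (nth false S) (size S) = count id S.
Proof.
by rewrite /prefix_count -(count_map (nth false S) id) -/(mkseq _ _) mkseq_nth.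
Qed.

Lemma card_ord_prefix (A : nat -> bool) n :
  #|[pred i : 'I_n | A i]| = prefix_count A n.
Proof.
rewrite /prefix_count -sum1_card -sum1_count.
by rewrite -[n in iota 0 n]subn0 -/(index_iota 0 n) big_mkord.
Qed.

(** A combinatorial substitute for the ergodic theorem.  Cut at a position [j]
    minimizing the excess q * |A `&` [0, j)| - j over the slope 1 / q: by
    minimality no prefix of the tail has a negative excess.  The hypothesis,
    with its twice larger slope, makes the total excess at least [n], whereas
    the excess is at most 0 at [j] and grows by at most q * (n - j) after it, so
    the tail is long. *)
Lemma dense_tail A q n m : (0 < q)%N ->
    (2 * n <= q * prefix_count A n)%N -> (q * m <= n)%N ->
  exists2 j, (j + m <= n)%N &
    forall k, (k <= m)%N ->
      (k <= q * prefix_count (fun i => A (j + i)%N) k)%N.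
Proof.
(* The excess is offset by n to stay among the natural numbers. *)
move=> q0 An qm; pose f j := (q * prefix_count A j + (n - j))%N.
have [[j jn1] _ /= jmin] :=
  @arg_minnP _ ord0 xpredT (fun j : 'I_n.+1 => f j) isT.
have {}jmin k : (k <= n)%N -> (f j <= f k)%N.
  by move=> kn; exact: (jmin (Ordinal (kn : (k < n.+1)%N))).
have jn : (j <= n)%N by rewrite -ltnS.
have mj : (j + m <= n)%N.
  rewrite -leq_subRL// -(leq_pmul2l q0); apply: leq_trans qm _.
  have := jmin 0%N (leq0n _); rewrite /f [prefix_count A 0]/= muln0 subn0 add0n.
  have := An; rewrite -{2}(subnKC jn) prefix_countD mulnDr.
  have := prefix_count_le (fun i => A (j + i)%N) (n - j).
  rewrite -(leq_pmul2l q0); lia.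
exists j => // k km.
have := jmin (j + k)%N; rewrite /f prefix_countD mulnDr; lia.
Qed.

(** * Independence on finite windows *)

Definition indep_upto (X : set cantor_space) (A : nat -> bool) n : Prop :=
  forall u : nat -> bool, exists2 x, X x &
    forall i, (i < n)%N -> A i -> x i = u i.

Lemma subshift_tail X x j : subshift X -> X x -> X (fun i => x (j + i)%N).
Proof.
move=> [_ sX] Xx; elim: j => [|j IHj]; first exact: Xx.
apply: sX; exists (fun i => x (j + i)%N) => //.
by apply/funext => i; rewrite /shift addSnnS.
Qed.

Lemma indep_upto_shift X A j n : subshift X ->
  indep_upto X A (j + n) -> indep_upto X (fun i => A (j + i)%N) n.
Proof.
move=> hX XA u; have [x Xx xu] := XA (fun i => u (i - j)%N).
exists (fun i => x (j + i)%N) => [|i ilt Ai].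
  exact: (subshift_tail j hX Xx).
by rewrite xu ?ltn_add2l// addKn.
Qed.

(** Points of [X] realizing longer and longer parts of a pattern accumulate at
    a point of [X] that realizes all of it. *)
Lemma indep_upto_all X A : closed X -> (forall n, indep_upto X A n) ->
  independence_set X [set i | A i].
Proof.
move=> clX XA; apply/seteqP; split=> // g _.
pose u i := if pselect ([set i | A i] i) is left Ai then
  g (SigSub (mem_set Ai)) else false.
have /choice[a aP] n :
    exists x, X x /\ forall i, (i < n)%N -> A i -> x i = u i.
  by have [x Xx xu] := XA n u; exists x.
have [x Xx ax] := agree_limit clX (fun m => (aP m).1).
exists x => //; apply/funext => -[i Ai].
have [k ik akx] := ax i.+1.
have Ai' := set_mem Ai.
rewrite /restriction set_valE /= -akx// (aP k).2//.
rewrite /u; case: pselect => // Ai''.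
by congr g; apply: val_inj.
Qed.

Lemma dense_independence_set X q : subshift X -> (0 < q)%N ->
    (forall m, exists2 n, (m <= n)%N & exists2 A, indep_upto X A n &
      (2 * n <= q * prefix_count A n)%N) ->
  exists2 A : nat -> bool, independence_set X [set i | A i] &
    forall k, (k <= q * prefix_count A k)%N.
Proof.
move=> hX q0 H.
have /choice[a aP] m : exists A : cantor_space, indep_upto X A m /\
    forall k, (k <= m)%N -> (k <= q * prefix_count A k)%N.
  have [n mn [A XA An]] := H (q * m)%N.
  have [j jn kA] := dense_tail q0 An mn.
  exists (fun i => A (j + i)%N); split => //.
  apply: (@indep_upto_shift X A j) => // u.
  have [x Xx xu] := XA u; exists x => // i ij; apply: xu.
  exact: leq_trans jn.
have [A _ aA] := @agree_limit setT a closedT (fun=> I).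
exists A => [|m].
  apply: indep_upto_all; first by case: hX.
  move=> n u; have [k nk akA] := aA n; have [x Xx xu] := (aP k).1 u.
  exists x => // i ni; rewrite -akA// => Ai.
  by apply: xu => //; exact: leq_trans nk.
have [k mk akA] := aA m.
by rewrite -(eq_prefix_count akA); exact: (aP k).2.
Qed.

(** * Counting words *)

Definition word_set (X : set cantor_space) n : {set n.-tuple bool} :=
  [set w | w \in words X n]%SET.

Lemma num_wordsE X n : num_words X n = #|word_set X n|.
Proof. by rewrite cardsE. Qed.

Lemma nth_ord_tuple (f : nat -> bool) n i : (i < n)%N ->
  nth false [tuple f (j : 'I_n) | j < n] i = f i.
Proof. by move=> ni; rewrite (nth_mktuple _ _ (Ordinal ni)). Qed.

Lemma in_word_set X n (w : n.-tuple bool) :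
  w \in word_set X n <->
  exists2 x, X x & forall i, (i < n)%N -> nth false w i = x i.
Proof.
rewrite inE; split => [/set_mem[x Xx <-]|[x Xx xw]].
  by exists x => // i; exact: nth_ord_tuple.
apply: mem_set; exists x => //; apply: eq_from_tnth => i.
by rewrite tnth_mktuple (tnth_nth false) xw.
Qed.

Lemma shattered_indep_upto X n S : size S = n -> shattered (word_set X n) S ->
  indep_upto X (nth false S) n.
Proof.
move=> nS XS u; have [w /in_word_set[x Xx xw] wu] := XS u.
by exists x => // i ni Si; rewrite -xw// wu.
Qed.

(** A word of length m + n is determined by its first m and last n letters, and
    in a subshift both are again words. *)
Lemma num_wordsD X m n : subshift X ->
  (num_words X (m + n) <= num_words X m * num_words X n)%N.
Proof.
move=> hX; rewrite !num_wordsE -cardsX.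
pose f (w : (m + n).-tuple bool) := ([tuple nth false w (i : 'I_m) | i < m],
  [tuple nth false w (m + (i : 'I_n))%N | i < n]).
have f_inj : injective f.
  move=> v w fvw; apply/val_inj/(@eq_from_nth _ false).
    by rewrite !size_tuple.
  move=> i; rewrite size_tuple => imn.
  have [im|mi] := ltnP i m.
    have := congr1 (fun p => tnth p.1 (Ordinal im)) fvw.
    by rewrite !tnth_mktuple.
  have ji : (i - m < n)%N by lia.
  have := congr1 (fun p => tnth p.2 (Ordinal ji)) fvw.
  by rewrite !tnth_mktuple /= subnKC.
rewrite -(card_imset _ f_inj).
apply/subset_leq_card/fintype.subsetP => _ /imsetP[w + ->].
move=> /in_word_set[x Xx xw].
rewrite inE /=; apply/andP; split; apply/in_word_set.
  by exists x => // i im; rewrite nth_ord_tuple// xw// ltn_addr.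
exists (fun i => x (m + i)%N) => [|i ni].
  exact: (subshift_tail m hX Xx).
rewrite (@nth_ord_tuple (fun i => nth false w (m + i)%N))//.
by rewrite xw// ltn_add2l.
Qed.

Lemma num_words_ge X n (A : nat -> bool) :
  indep_upto X A n -> (2 ^ prefix_count A n <= num_words X n)%N.
Proof.
move=> XA; pose D := [set i : 'I_n | A i]%SET.
have -> : prefix_count A n = #|D| by rewrite cardsE card_ord_prefix.
rewrite -card_powerset num_wordsE.
pose trace (w : n.-tuple bool) := [set i | i \in D & tnth w i]%SET.
apply: leq_trans (leq_imset_card trace _).
apply/subset_leq_card/fintype.subsetP => B.
rewrite powersetE => /fintype.subsetP BD.
have [x Xx xB] :=
  XA (fun i => [exists j : 'I_n, (j \in B) && (j == i :> nat)]).
apply/imsetP; exists [tuple x (i : 'I_n) | i < n].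
  by apply/in_word_set; exists x => // i; exact: nth_ord_tuple.
apply/setP => i; rewrite !inE tnth_mktuple; apply/idP/andP => [iB|[Ai]].
  have := BD _ iB; rewrite inE => Ai; split; rewrite ?xB//.
  by apply/existsP; exists i; rewrite iB eqxx.
by rewrite xB// => /existsP[j /andP[jB /eqP/val_inj <-]].
Qed.

(** * Existence of the entropy *)

(** Fekete's lemma.  Fix M with a M / M close to the infimum of all a n / n and
    write n = k * M + r with r < M: then a n <= k * a M + a r, where a r is
    bounded by a constant depending on M alone. *)
Lemma fekete (R : realType) (a : nat -> R) : (forall n, 0 <= a n) ->
  (forall m n, a (m + n)%N <= a m + a n) -> cvgn (fun n => a n / n%:R).
Proof.
move=> a0 aD; pose E := [set a n.+1 / n.+1%:R | n in [set: nat]].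
have E0 n : 0 <= a n.+1 / n.+1%:R by rewrite divr_ge0.
have lbE : has_lbound E by exists 0 => _ [n _ <-].
have nE : nonempty E by exists (a 1%N / 1%:R), 0%N.
pose l := inf E.
have l_le n : (0 < n)%N -> l <= a n / n%:R.
  by case: n => // n _; apply: ge_inf => //; exists n.
have l0 : 0 <= l by apply: lb_le_inf => // _ [n _ <-].
have aDM m k r : a (k * m + r)%N <= k%:R * a m + a r.
  elim: k => [|k IHk]; first by rewrite mul0r add0r.
  rewrite mulSn -addnA (le_trans (aD _ _))// -[k.+1]addn1 natrD mulrDl mul1r.
  by rewrite [leRHS]addrAC [leRHS]addrC lerD2l.
apply/cvg_ex; exists l; apply/cvgrPdist_le => e e0.
have [||_ [m _ <-] ml] := @inf_adherent R E (e / 2); first by rewrite divr_gt0.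
  by split.
set M := m.+1 in ml; pose C := M%:R * a 1%N + a 0%N.
have C0 : 0 <= C by rewrite addr_ge0 ?mulr_ge0.
exists (Num.truncn (C / (e / 2))).+1 => // n /= nC.
have n0 : (0 < n)%N by exact: leq_trans nC.
have n0R : 0 < n%:R :> R by rewrite ltr0n.
rewrite distrC ger0_norm ?subr_ge0 ?l_le// lerBlDr ler_pdivrMr//.
have Cn : C <= e / 2 * n%:R.
  rewrite mulrC -ler_pdivrMr ?divr_gt0// ltW//.
  by rewrite (lt_le_trans (truncnS_gt _))// ler_nat.
have aM : a M <= (l + e / 2) * M%:R by rewrite -ler_pdivrMr ?ltr0n// ltW.
have r_le : a (n %% M)%N <= C.
  have := aDM 1%N (n %% M)%N 0%N; rewrite muln1 addn0 => /le_trans -> //.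
  by rewrite lerD2r ler_wpM2r// ler_nat ltnW// ltn_mod.
have kM : (n %/ M)%:R * M%:R <= n%:R :> R by rewrite -natrM ler_nat leq_divM.
have := aDM M (n %/ M)%N (n %% M)%N; rewrite -divn_eq => /le_trans; apply.
have kaM : (n %/ M)%:R * a M <= (l + e / 2) * n%:R.
  rewrite (le_trans (ler_wpM2l _ aM))// mulrCA ler_wpM2l//.
  by rewrite addr_ge0// divr_ge0// ltW.
rewrite (le_trans (lerD kaM (le_trans r_le Cn)))//.
by rewrite -mulrDl -addrA -splitr addrC.
Qed.

Lemma ln_nat_ge0 (R : realType) n : 0 <= ln n%:R :> R.
Proof. by case: n => [|n]; [rewrite ln0 | rewrite ln_ge0// ler1n]. Qed.

Lemma cvg_entropy (R : realType) X : subshift X ->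
  cvgn (fun n => ln (num_words X n)%:R / n%:R : R).
Proof.
move=> hX; apply: (@fekete R (fun n => ln (num_words X n)%:R)) => [n|m n].
  exact: ln_nat_ge0.
(* The empty subshift has no words, and ln 0 = 0. *)
have [->|W0] := posnP (num_words X (m + n)).
  by rewrite ln0// addr_ge0// ln_nat_ge0.
have WD := num_wordsD m n hX.
have := leq_trans W0 WD; rewrite muln_gt0 => /andP[Wm Wn].
rewrite -lnM ?posrE ?ltr0n// -natrM ler_ln ?posrE ?ltr0n ?muln_gt0 ?Wm//.
by rewrite ler_nat.
Qed.

(** * Lower density and entropy *)

Lemma limn_inf_gt0P (R : realType) (u : R^nat) :
    has_ubound (range u) -> has_lbound (range u) ->
  0 < limn_inf u <-> exists2 d, 0 < d & \forall n \near \oo, d <= u n.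
Proof.
move=> ubu lbu; have -> : limn_inf u = sup (range (infs u)).
  by apply/cvg_lim => //; exact: cvg_infs_sup.
split=> [/sup_gt[]|[d d0 [m _ du]]].
- by exists (infs u 0%N), 0%N.
- move=> _ [m _ <-] d0; exists (infs u m) => //.
  exists m => // n /= mn; apply: ge_inf; first exact: has_lbound_sdrop.
  by exists n.
- apply: (lt_le_trans d0); apply: (@le_trans _ _ (infs u m)).
    apply: lb_le_inf; first by exists (u m), m => /=.
    by move=> _ [n mn <-]; exact: du.
  apply: ub_le_sup; last by exists m.
  have [M uM] := ubu; exists M => _ [k _ <-].
  apply: (@le_trans _ _ (u k)); last by apply: uM; exists k.
  by apply: ge_inf; [exact: has_lbound_sdrop|exists k => /=].
Qed.

Lemma lower_density_gt0P (R : realType) (A : nat -> bool) :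
  0 < lower_density R [set i | A i] <->
  exists2 d : R, 0 < d & \forall n \near \oo, d * n%:R <= (prefix_count A n)%:R.
Proof.
have uE n : #|[pred i : 'I_n | val i \in [set i | A i]]| = prefix_count A n.
  rewrite -card_ord_prefix; apply: eq_card => i; rewrite !inE.
  by apply/idP/idP => [/set_mem|/mem_set].
rewrite /lower_density; under eq_fun do rewrite uE.
rewrite limn_inf_gt0P; last 2 first.
- exists 1 => _ [n _ <-]; have [->|n0] := posnP n; first by rewrite invr0 mulr0.
  by rewrite ler_pdivrMr ?ltr0n// mul1r ler_nat prefix_count_le.
- by exists 0 => _ [n _ <-]; rewrite divr_ge0.
split=> -[d d0 [m _ dm]]; exists d => //; exists m.+1 => // n /= mn.
  by rewrite -ler_pdivlMr ?ltr0n ?(leq_trans _ mn)//; apply: dm; exact: ltnW.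
by rewrite ler_pdivlMr ?ltr0n ?(leq_trans _ mn)//; apply: dm; exact: ltnW.
Qed.

(** If every shattered set of positions had size at most d, then
    [card_shattered_le] would give, for n large and 2 * t below the entropy,
    2 * t * n <= n * ln (1 + t) + d * ln (1 / t) <= n * t + d * ln (1 / t), so
    that d >= n * t / ln (1 / t): the size of the largest shattered set is at
    least proportional to n. *)
Lemma entropy_shattered (R : realType) X : subshift X -> 0 < entropy R X ->
  exists2 q, (0 < q)%N & \forall n \near \oo,
    exists2 A, indep_upto X A n & (2 * n <= q * prefix_count A n)%N.
Proof.
move=> hX h0; pose t := Num.min (entropy R X / 3) (1 / 2).
have t0 : 0 < t by rewrite lt_min !divr_gt0.
have t1 : t < 1 by rewrite gt_min; apply/orP; right; lra.
have th : 2 * t < entropy R X.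
  have : t <= entropy R X / 3 by rewrite ge_min lexx.
  by move: h0; lra.
have L0 : 0 <= - ln t by rewrite oppr_ge0 ln_le0// ltW.
(* Any factor larger than 2 makes the final inequalities contradictory. *)
pose q := (Num.truncn (3 * - ln t / t)).+1.
have qt : 3 * - ln t <= q%:R * t.
  by rewrite -ler_pdivrMr// ltW// truncnS_gt.
exists q => //.
have ent := cvg_entropy (R := R) hX.
have : \forall n \near \oo, 2 * t < ln (num_words X n)%:R / n%:R.
  exact: (cvgr_gt (entropy R X)).
move=> [n0 _ hn]; exists n0.+1 => // n /= n0n.
have npos : (0 < n)%N by exact: leq_trans n0n.
have nR : 0 < n%:R :> R by rewrite ltr0n.
have := hn n (ltnW n0n); rewrite ltr_pdivlMr// => hW.
have W0 : (0 < num_words X n)%N.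
  rewrite lt0n; apply: contraTneq hW => ->.
  by rewrite ln0// -leNgt !mulr_ge0// ltW.
apply: contrapT => noA.
have /card_shattered_le small : 0 < t <= 1 by rewrite t0 ltW.
have {small} := small n (word_set X n) (2 * n %/ q)%N.
rewrite -num_wordsE => /(_ _)/wrap[S nS SS|].
  rewrite leqNgt; apply/negP => dS; apply: noA.
  exists (nth false S); first exact: shattered_indep_upto SS.
  rewrite -[in prefix_count _ n]nS prefix_count_nth mulnC [leqRHS]mulnC.
  by move: dS; rewrite ltn_divLR// => /ltnW; rewrite mulnC.
set d := (_ %/ _)%N => small.
have dq : d%:R * q%:R <= 2 * n%:R :> R by rewrite -!natrM ler_nat leq_divM.
have : ln (num_words X n)%:R + d%:R * ln t <= n%:R * t.
  rewrite [d%:R * _]mulr_natl -lnXn// -lnM ?posrE ?ltr0n ?exprn_gt0//.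
  apply: (@le_trans _ _ (ln ((1 + t) ^+ n))).
    by rewrite ler_ln// posrE ?mulr_gt0 ?ltr0n ?exprn_gt0// addr_gt0.
  rewrite lnXn ?addr_gt0// [leRHS]mulr_natl ler_wMn2r// le_ln1Dx//.
  exact: lt_trans (ltrN10 R) t0.
have : d%:R * (3 * - ln t) <= 2 * n%:R * t.
  apply: le_trans (ler_wpM2l (ler0n _ _) qt) _.
  by rewrite mulrA ler_wpM2r// ltW.
have : 0 < n%:R * t by rewrite mulr_gt0.
move: hW; clear; lra.
Qed.

Theorem corollary1 (R : realType) (X : set cantor_space) (hX : subshift X) :
  0 < entropy R X <->
  exists N : set nat, independence_set X N /\ 0 < lower_density R N.
Proof.
split=> [h0|[N [NX N0]]].
- have [q q0 [n0 _ qA]] := entropy_shattered hX h0.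
  have [m|A AX kA] := dense_independence_set hX q0.
    by exists (maxn m n0); [exact: leq_maxl|apply: qA; exact: leq_maxr].
  exists [set i | A i]; split => //; apply/lower_density_gt0P.
  exists q%:R^-1; first by rewrite invr_gt0 ltr0n.
  exists 0%N => // n _.
  by rewrite mulrC ler_pdivrMr ?ltr0n// -natrM ler_nat mulnC.
- pose A i := i \in N.
  have NA : N = [set i | A i] by apply/seteqP; split=> i; rewrite /= inE.
  have AX n : indep_upto X A n.
    move=> u; have : [set: N -> bool] (fun i => u (set_val i)) by [].
    rewrite -NX => -[x Xx xu]; exists x => // i _ Ai.
    exact: (congr1 (fun g => g (SigSub Ai)) xu).
  move: N0; rewrite NA => /lower_density_gt0P[d d0 dA].
  have l2 : 0 < ln 2 :> R by rewrite ln_gt0// ltr1n.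
  apply: (@lt_le_trans _ _ (d * ln 2)); first by rewrite mulr_gt0.
  apply: limr_ge; first exact: cvg_entropy.
  near=> n; have n0 : (0 < n)%N by near: n; exists 1%N.
  rewrite ler_pdivlMr ?ltr0n// mulrAC.
  apply: (@le_trans _ _ ((prefix_count A n)%:R * ln 2)).
    by rewrite ler_wpM2r ?(ltW l2)//; near: n.
  rewrite mulr_natl -lnXn// ler_ln ?posrE ?exprn_gt0// -?natrX ?ler_nat ?ltr0n.
    exact: num_words_ge.
  by rewrite (leq_trans _ (num_words_ge (AX n)))// expn_gt0.
Unshelve. all: by end_near. Qed.
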